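(* Let $\mathcal{U}$ be a real reflexive Banach space, $\mathcal{V}$ a real Banach space, let $J:\mathcal{U}\to\mathbb{R}$ be Gateaux differentiable with derivative $J'$, and let $\Gamma:\mathcal{U}\to\mathcal{V}$ be a bounded linear map. Let $\{\psi_j\}_{j\ge1}$ be a complete system in the dual space $\mathcal{V}^*$, and set $\mathring{\mathcal{U}}:=\{u\in\mathcal{U}\mid\Gamma u=0\}$ and $\mathring{\mathcal{U}}_s:=\{u\in\mathcal{U}\mid\langle\psi_j,\Gamma u\rangle=0,\ 1\le j\le s\}$. Suppose that for some $s_0$ the functional $J$ grows at infinity on $\mathring{\mathcal{U}}_{s_0}$, and that there is a continuous (strictly) monotone increasing function $c:[0,\infty)\to[0,\infty)$ with $c(0)=0$ such that $$\langle J'(u)-J'(v),u-v\rangle\ \ge\ c(\|u-v\|)\qquad\text{for all }u,v\in\mathring{\mathcal{U}}_{s_0}.$$ Then $J$ has a minimizer $\overline{u}$ on $\mathring{\mathcal{U}}$, as well as minimizers $\overline{u}_s$ on all $\mathring{\mathcal{U}}_s$ with $s\ge s_0$, and $\overline{u}_s\to\overline{u}$ in the norm of $\mathcal{U}$ as $s\to\infty$. The values $J(\overline{u}_s)$ converge to the minimum of $J$ on $\mathring{\mathcal{U}}$.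
   Context: A system $\{\psi_j\}_{j\ge1}$ of elements of a Banach space is called complete if every element of the space can be approximated in norm to any given precision by finite linear combinations of the $\psi_j$. $J$ is Gateaux differentiable on $\mathcal{U}$ if at every $u\in\mathcal{U}$ its first variation $\frac{d}{dt}J(u+t\,\delta u)\big|_{t=0}$ exists and is linear and bounded in $\delta u$, thus defining a derivative $J'(u)\in\mathcal{U}^*$. $J$ grows at infinity on a subspace $\mathcal{W}\subseteq\mathcal{U}$ if $J(u)\to\infty$ as $\|u\|\to\infty$ with $u\in\mathcal{W}$. The brackets $\langle\cdot,\cdot\rangle$ denote the pairing between a Banach space and its dual. *)

(* Defs.v *)
From HB Require Import structures.
From mathcomp Require Import all_boot all_order all_algebra.
From mathcomp Require Import all_classical all_reals all_analysis.

Set Implicit Arguments.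
Unset Strict Implicit.
Unset Printing Implicit Defensive.

Import Order.TTheory GRing.Theory Num.Theory.
Import numFieldNormedType.Exports.

Local Open Scope classical_set_scope.
Local Open Scope ring_scope.

Section dual_space.
Context {R : realType} (V : normedModType R).

Definition bounded_functional : {pred V -> R^o} :=
  mem [set f : V -> R^o | linear f /\ bounded_near f (nbhs (0 : V))].

Lemma bounded_functionalP (f : V -> R^o) : f \in bounded_functional <->
  linear f /\ exists C : R, forall v, `|f v| <= C * `|v|.
Proof.
rewrite inE /=; split=> -[lf bf]; split => //.
  pose g : {linear V -> R^o} := HB.pack f (GRing.isLinear.Build _ _ _ _ _ lf).
  have /linear_boundedP/pinfty_ex_gt0[C _ fC] : bounded_near g (nbhs (0 : V)).
    exact: bf.
  by exists C.
have [C fC] := bf; apply/ex_bound; exists `|C|.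
apply/nbhs_norm0P; exists 1 => //= v /= v1; apply: (le_trans (fC v)).
apply: (le_trans (ler_norm _)); rewrite normrM normr_id.
by rewrite ler_piMr// ltW.
Qed.

Lemma bounded_functional_submod : submod_closed bounded_functional.
Proof.
split.
  apply/bounded_functionalP; split; first by move=> a u v /=; rewrite scaler0 addr0.
  by exists 0 => v; rewrite normr0 mul0r.
move=> a f g /bounded_functionalP[lf [C fC]] /bounded_functionalP[lg [D gD]].
apply/bounded_functionalP; split.
  move=> k u v; rewrite !fctE lf lg !scalerDr !scalerA (mulrC k a) !addrA.
  by congr (_ + _); rewrite -!addrA; congr (_ + _); rewrite addrC.
exists (`|a| * C + D) => v; rewrite !fctE (le_trans (ler_normD _ _))//.
rewrite mulrDl lerD// normrZ -mulrA; exact: ler_wpM2l.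
Qed.

HB.instance Definition _ :=
  GRing.isSubmodClosed.Build R (V -> R^o) bounded_functional
    bounded_functional_submod.

Record dual := Dual {
  dual_fun :> V -> R^o ;
  dual_funP : dual_fun \in bounded_functional }.

HB.instance Definition _ := [isSub for dual_fun].
HB.instance Definition _ := [Choice of dual by <:].
HB.instance Definition _ := [SubChoice_isSubLmodule of dual by <:].

Implicit Types f g : dual.

HB.instance Definition _ f :=
  GRing.isLinear.Build R V R^o _ (dual_fun f)
    (proj1 (proj1 (bounded_functionalP f) (dual_funP f))).

Lemma dual_bounded f : exists C : R, forall v, `|f v| <= C * `|v|.
Proof. exact: (proj2 (proj1 (bounded_functionalP f) (dual_funP f))). Qed.

Definition dual_norm f : R := sup [set `|f v| | v in [set v : V | `|v| <= 1]].

Lemma dual_norm_has_sup f : has_sup [set `|f v| | v in [set v : V | `|v| <= 1]].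
Proof.
split; first by exists `|f 0|, 0; rewrite //= normr0.
have [C fC] := dual_bounded f; exists `|C| => _ [v /= v1 <-].
apply: (le_trans (fC v)); apply: (le_trans (ler_norm _)).
by rewrite normrM normr_id ler_piMr.
Qed.

Lemma dual_norm_ub f v : `|v| <= 1 -> `|f v| <= dual_norm f.
Proof. by move=> v1; apply: (sup_upper_bound (dual_norm_has_sup f)); exists v. Qed.

Lemma dual_norm_le f (C : R) :
  (forall v, `|v| <= 1 -> `|f v| <= C) -> dual_norm f <= C.
Proof.
move=> fC; apply: ge_sup; first exact: (dual_norm_has_sup f).1.
by move=> _ [v /= v1 <-]; exact: fC.
Qed.

Lemma dual_norm_ge0 f : 0 <= dual_norm f.
Proof. by apply: le_trans (@dual_norm_ub f 0 _) => //; rewrite normr0. Qed.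

Lemma dual_normP f v : `|f v| <= dual_norm f * `|v|.
Proof.
have [->|v0] := eqVneq v 0; first by rewrite linear0 !normr0 mulr0.
rewrite -ler_pdivrMr ?normr_gt0//.
have := @dual_norm_ub f (`|v|^-1 *: v); rewrite normfZV// => /(_ (lexx _)).
by rewrite linearZ normrZ normfV normr_id mulrC.
Qed.

Lemma dual_normD f g : dual_norm (f + g) <= dual_norm f + dual_norm g.
Proof.
apply: dual_norm_le => v v1; apply: (le_trans (ler_normD _ _)).
by rewrite lerD// dual_norm_ub.
Qed.

Lemma dual_normZ (a : R) f : dual_norm (a *: f) = `|a| * dual_norm f.
Proof.
have le_normZ b h : dual_norm (b *: h) <= `|b| * dual_norm h.
  apply: dual_norm_le => v v1; rewrite [(b *: h) v]/(b *: h v) normrZ.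
  by rewrite ler_wpM2l// dual_norm_ub.
apply/le_anti; rewrite le_normZ/=.
have [->|a0] := eqVneq a 0; first by rewrite normr0 mul0r dual_norm_ge0.
rewrite -ler_pdivlMl ?normr_gt0// -normfV.
by have := le_normZ a^-1 (a *: f); rewrite scalerA mulVf// scale1r.
Qed.

Lemma dual_norm_eq0 f : dual_norm f = 0 -> f = 0.
Proof.
move=> f0; apply/val_inj/funext => v; apply/eqP; rewrite -normr_le0.
by have := dual_normP f v; rewrite f0 mul0r.
Qed.

HB.instance Definition _ :=
  Lmodule_isNormed.Build R dual dual_normD dual_normZ dual_norm_eq0.

End dual_space.

(* The natural map of U into its bidual is always isometric, so reflexivity is
   its surjectivity. *)
Definition reflexive_space (R : realType) (U : normedModType R) : Prop :=
  forall F : dual (dual U), exists u : U, forall phi : dual U, F phi = phi u.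

Definition complete_system (R : realType) (E : normedModType R)
    (psi : nat -> E) : Prop :=
  forall (x : E) (e : R), 0 < e ->
    exists (n : nat) (a : 'I_n -> R), `|x - \sum_(j < n) a j *: psi j| < e.

(* J' u is the derivative of J at u: for every direction du, the first variation
   of J at u along du exists and equals J' u du. *)
Definition gateaux_derivative (R : realType) (U : normedModType R)
    (J : U -> R) (J' : U -> dual U) : Prop :=
  forall u du : U, is_derive u du (J : U -> R^o) (J' u du).

Definition grows_at_infinity (R : realType) (U : normedModType R)
    (J : U -> R) (W : set U) : Prop :=
  forall A : R, exists r : R, forall u, W u -> r <= `|u| -> A <= J u.

Definition minimizer (R : realType) (U : normedModType R)
    (J : U -> R) (W : set U) (u : U) : Prop :=
  W u /\ forall v, W v -> J u <= J v.

Definition kernel_space (R : realType) (U V : normedModType R)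
    (Gamma : U -> V) : set U := [set u | Gamma u = 0].

(* psi is indexed from 0, psi j standing for the (j+1)-st functional, so that
   j < s selects the first s of them. *)
Definition approx_space (R : realType) (U V : normedModType R)
    (Gamma : U -> V) (psi : nat -> dual V) (s : nat) : set U :=
  [set u | forall j : nat, (j < s)%N -> psi j (Gamma u) = 0].

(* Main.v *)
From HB Require Import structures.
Require Import Defs.
From mathcomp Require Import all_boot all_order all_algebra.
From mathcomp Require Import all_classical all_reals all_analysis.
From mathcomp Require Import ring lra.

Import Order.TTheory GRing.Theory Num.Theory.
Import numFieldNormedType.Exports.

(** Write [D] for the approximate kernel of index [s0].  Integrating the
    monotonicity of [J'] along segments of [D] turns it into a quantitative
    convexity of [J],
      [J ((u + v) / 2) + w |u - v| <= (J u + J v) / 2],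
    where [w] is positive and nondecreasing on positive numbers
    ([monotone_derivative_midpoint]); it also gives the supporting functional
    [J' u] at every [u], hence lower semicontinuity, and a lower bound of [J]
    on bounded sets.  Together with growth at infinity, [J] is bounded below
    on [D] ([growing_bounded_below]).

    Existence and convergence both follow from [minimizing_sequence_cvg].
    Let [W n] be a decreasing sequence of closed affine subsets of [D] with a
    common point, and let [u n] minimize [J] on [W n] up to an error tending
    to 0.  For [n <= k] the midpoint of [u n] and [u k] lies in [W n], where
    [J] is not much smaller than [J (u n)], so the inequality above bounds
    [w |u n - u k|] by half of [J (u k) - J (u n)], up to the error.  The values
    [J (u n)] are almost nondecreasing and bounded by the value of [J] at a
    common point; they converge, [u] is a Cauchy sequence, and by lower
    semicontinuity its limit minimizes [J] on the intersection of the [W n].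
    For a constant sequence [W] this is the existence of a minimizer; for the
    approximate kernels it is the convergence, once the intersection of these
    is known to be the kernel of [Gamma].

    That intersection is the content of [kernel_space_bigcap]: by completeness
    of the system every functional vanishes at [Gamma u] if all [psi j] do, and
    by the Hahn-Banach theorem ([dual_separates]) [Gamma u] is then 0. *)

Local Open Scope classical_set_scope.
Local Open Scope ring_scope.

(** * Sublinear functionals and the Hahn-Banach theorem *)

Definition sublinear {R : realType} {V : lmodType R} (q : V -> R) : Prop :=
  (forall x y, q (x + y) <= q x + q y) /\
  (forall (t : R) x, 0 <= t -> q (t *: x) <= t * q x).

Section Sublinear.
Context {R : realType} {V : lmodType R}.
Implicit Types (p q : V -> R).

Lemma sublinear0 q : sublinear q -> q 0 = 0.
Proof.
move=> [qD qZ]; apply/le_anti/andP; split.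
  by have := qZ 0 0 (lexx _); rewrite scale0r mul0r.
by have := qD 0 0; rewrite addr0; lra.
Qed.

Lemma sublinear_oppr q x : sublinear q -> - q (- x) <= q x.
Proof.
move=> sq; have := sq.1 x (- x); rewrite subrr (sublinear0 q)//; lra.
Qed.

Lemma sublinearZ q (t : R) x : sublinear q -> 0 <= t ->
  q (t *: x) = t * q x.
Proof.
move=> sq; rewrite le_eqVlt => /predU1P[<-|t0].
  by rewrite scale0r mul0r sublinear0.
apply/le_anti; rewrite (sq.2 _ _ (ltW t0))/= -ler_pdivlMl//.
have := sq.2 t^-1 (t *: x); rewrite scalerA mulVf ?gt_eqF// scale1r; apply.
by rewrite invr_ge0 ltW.
Qed.

(** The common shape of the two infima formed below: one over the functions of
    a chain, the other over a parameter that moves with the argument.  Hence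
    the sets [S x] of values, instead of a family of sublinear functions. *)
Lemma sublinear_inf (S : V -> set R) :
  (forall x, has_inf (S x)) ->
  (forall x y a b, S x a -> S y b -> exists2 c, S (x + y) c & c <= a + b) ->
  (forall x (t : R) a, 0 <= t -> S x a ->
    exists2 c, S (t *: x) c & c <= t * a) ->
  sublinear (fun x => inf (S x)).
Proof.
move=> hS SD SZ.
have infP x a : S x a -> inf (S x) <= a by apply: ge_inf; exact: (hS x).2.
split=> [x y|t x t0].
  rewrite /= -lerBlDr; apply: lb_le_inf; first exact: (hS x).1.
  move=> a Sa; rewrite lerBlDr -lerBlDl.
  apply: lb_le_inf; first exact: (hS y).1.
  move=> b Sb; rewrite lerBlDl.
  by have [c /infP Sc cab] := SD x y a b Sa Sb; exact: le_trans cab.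
move: t0; rewrite le_eqVlt => /predU1P[t0|t0].
  have [a Sa] := (hS x).1.
  have [c /infP Sc] := SZ x 0 a (lexx _) Sa.
  by rewrite /= -t0 !mul0r; apply: le_trans.
rewrite /= -ler_pdivrMl//; apply: lb_le_inf; first exact: (hS x).1.
move=> a Sa; rewrite ler_pdivrMl//.
by have [c /infP Sc] := SZ x t a (ltW t0) Sa; exact: le_trans.
Qed.

(** The largest sublinear function below [q] that takes at [- y] a value at most
    [- q y]. *)
Definition shift_inf q (y x : V) : R :=
  inf [set q (x + t *: y) - t * q y | t in [set t : R | 0 <= t]].

Lemma shift_inf_has_inf q y x : sublinear q ->
  has_inf [set q (x + t *: y) - t * q y | t in [set t : R | 0 <= t]].
Proof.
move=> sq; split; first by exists (q (x + 0 *: y) - 0 * q y), 0 => /=.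
exists (- q (- x)) => _ [t /= t0 <-].
have := sq.1 (x + t *: y) (- x); rewrite addrAC subrr add0r sublinearZ//; lra.
Qed.

Lemma shift_inf_le q y x (t : R) : sublinear q -> 0 <= t ->
  shift_inf q y x <= q (x + t *: y) - t * q y.
Proof.
move=> sq t0; apply: ge_inf; first exact: (shift_inf_has_inf _ _ _ sq).2.
by exists t.
Qed.

Lemma shift_inf_le_id q y x : sublinear q -> shift_inf q y x <= q x.
Proof.
move=> sq; have := shift_inf_le q y x 0 sq (lexx _).
by rewrite scale0r mul0r addr0 subr0.
Qed.

Lemma shift_inf_sublinear q y : sublinear q ->
  sublinear (shift_inf q y).
Proof.
move=> sq; apply: sublinear_inf.
- by move=> x; exact: shift_inf_has_inf.
- move=> x1 x2 _ _ [s /= s0 <-] [t /= t0 <-].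
  exists (q (x1 + x2 + (s + t) *: y) - (s + t) * q y).
    by exists (s + t) => //=; exact: addr_ge0.
  have := sq.1 (x1 + s *: y) (x2 + t *: y).
  rewrite addrACA -scalerDl; lra.
- move=> x s _ s0 [t /= t0 <-].
  exists (q (s *: x + (s * t) *: y) - (s * t) * q y).
    by exists (s * t) => //=; exact: mulr_ge0.
  have := sq.2 s (x + t *: y) s0.
  rewrite scalerDr scalerA; lra.
Qed.

(** Minimality forces [shift_inf q y = q], and the value 1 of the parameter then
    gives the superadditivity [q x + q y <= q (x + y)]. *)
Lemma minimal_sublinear_linear q : sublinear q ->
  (forall q', sublinear q' -> (forall x, q' x <= q x) -> q' = q) ->
  linear (q : V -> R^o).
Proof.
move=> sq qmin.
have qD x y : q (x + y) = q x + q y.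
  apply/le_anti; rewrite sq.1/=.
  have shiftE : shift_inf q y = q.
    apply: qmin => [|z]; first exact: shift_inf_sublinear.
    exact: shift_inf_le_id.
  have := shift_inf_le q y x 1 sq ler01.
  by rewrite shiftE scale1r mul1r; lra.
have qN x : q (- x) = - q x.
  by have := qD x (- x); rewrite subrr sublinear0//; lra.
move=> a x y; rewrite [LHS]qD; congr (_ + _).
have [a0|a0] := leP 0 a; first by rewrite sublinearZ.
rewrite -[a *: x]opprK -scaleNr qN sublinearZ// ?oppr_ge0 ?ltW//.
by rewrite mulNr opprK.
Qed.

(** Zorn's lemma gives a minimal sublinear function below [p]: a chain has its
    pointwise infimum as a lower bound, finite because every [s] in it satisfies
    [- p (- x) <= - s (- x) <= s x]. *)
Lemma sublinear_dominates_linear p : sublinear p ->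
  exists q : V -> R, linear (q : V -> R^o) /\ forall x, q x <= p x.
Proof.
move=> sp.
pose P (q : V -> R) := sublinear q /\ forall x, q x <= p x.
pose T := {q : V -> R | P q}.
pose below (s t : T) : bool := `[< forall x, sval t x <= sval s x >].
have [|||C totC|[q [sq qp]] qmin] := @Zorn T below.
- by move=> s; apply/asboolP.
- move=> r s t /asboolP rs /asboolP st; apply/asboolP => x.
  exact: le_trans (st x) (rs x).
- move=> [s ps] [t pt] /asboolP /= st /asboolP /= ts.
  apply: eq_exist => /=.
  by apply/funext => x; apply/le_anti; rewrite ts st.
- have [->|/set0P[s0 Cs0]] := eqVneq C set0.
    by exists (exist P p (conj sp (fun x => lexx _))).
  pose S x : set R := [set sval s x | s in C].
  have hS x : has_inf (S x).
    split; first by exists (sval s0 x), s0.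
    exists (- p (- x)) => _ [s Cs <-]; have [ss sle] := svalP s.
    rewrite (le_trans _ (sublinear_oppr _ _ ss))// lerN2; exact: sle.
  have infS s x : C s -> inf (S x) <= sval s x.
    by move=> Cs; apply: ge_inf; [exact: (hS x).2|exists s].
  have sinf : sublinear (fun x => inf (S x)).
    apply: sublinear_inf => //.
      move=> x y _ _ [s Cs <-] [t Ct <-].
      have [/asboolP st|/asboolP ts] := totC _ _ Cs Ct.
        exists (sval t (x + y)); first by exists t.
        by rewrite (le_trans ((svalP t).1.1 _ _))// lerD2r.
      exists (sval s (x + y)); first by exists s.
      by rewrite (le_trans ((svalP s).1.1 _ _))// lerD2l.
    move=> x t _ t0 [s Cs <-]; exists (sval s (t *: x)); first by exists s.
    exact: (svalP s).1.2.
  have infp x : inf (S x) <= p x.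
    by rewrite (le_trans (infS s0 x Cs0))//; exact: (svalP s0).2.
  exists (exist P _ (conj sinf infp)) => s Cs; apply/asboolP => x /=.
  exact: infS.
exists q; split => //; apply: minimal_sublinear_linear => // q' sq' q'q.
have q'p x : q' x <= p x by rewrite (le_trans (q'q x)).
suff /(congr1 sval) : exist P q' (conj sq' q'p) = exist P q (conj sq qp) by [].
by apply: qmin; apply/asboolP.
Qed.

End Sublinear.

(** A linear function below [shift_inf] of the norm at [v] is bounded by the
    norm and takes at [v] the value [`|v|]. *)
Lemma dual_separates (R : realType) (V : normedModType R) (v : V) :
  (forall phi : dual V, phi v = 0) -> v = 0.
Proof.
move=> v0.
have snorm : sublinear (fun x : V => `|x|).
  split=> [x y|t x t0]; first exact: ler_normD.
  by rewrite normrZ ger0_norm.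
have [q [linq qle]] :=
  sublinear_dominates_linear _ (shift_inf_sublinear _ v snorm).
have qnorm x : q x <= `|x|.
  exact: le_trans (qle x) (shift_inf_le_id _ v x snorm).
pose f : {linear V -> R^o} :=
  HB.pack (q : V -> R^o) (GRing.isLinear.Build _ _ _ _ _ linq).
have qN x : q (- x) = - q x by exact: (linearN f).
have bq : (q : V -> R^o) \in @bounded_functional R V.
  apply/bounded_functionalP; split => //; exists 1 => x; rewrite mul1r.
  by rewrite ler_norml qnorm andbT lerNl -qN -(normrN x).
have qv : q v = 0 := v0 (Dual bq).
have := le_trans (qle (- v)) (shift_inf_le _ v (- v) 1 snorm ler01).
rewrite qN qv scale1r addNr normr0 mul1r oppr0 add0r oppr_ge0 => vle0.
by apply/eqP; rewrite -normr_le0.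
Qed.


(** * Convexity from a monotone derivative *)

Lemma gateaux_derivative_line (R : realType) (U : normedModType R)
    (J : U -> R) (J' : U -> dual U) (u h : U) (t : R) :
  gateaux_derivative J J' ->
  is_derive t 1 (fun t : R => J (u + t *: h) : R^o) (J' (u + t *: h) h).
Proof.
move=> dJ; have [dex dval] := dJ (u + t *: h) h.
have E : (fun s : R => s^-1 *: (((fun t : R => J (u + t *: h) : R^o) \o shift t)
      (s *: 1) - J (u + t *: h)))
    = (fun s : R => s^-1 *: (((J : U -> R^o) \o shift (u + t *: h)) (s *: h)
      - J (u + t *: h))).
  apply/funext => s /=; congr (_ *: (J _ - _)).
  by rewrite [s *: 1]mulr1 scalerDl addrCA addrA.
split; first by rewrite /derivable E; exact: dex.
by rewrite /derive E; exact: dval.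
Qed.

Definition affine_set {R : realType} {U : lmodType R} (W : set U) : Prop :=
  forall u v (t : R), W u -> W v -> W (u + t *: (v - u)).

(** The derivative of [J] along the segment from [u] to [v] exceeds its initial
    value by at least [c (t |v - u|) / t] at time [t].  On the first half of the
    segment only the nonnegativity of this excess is used; on the second half
    it is at least [c (|v - u| / 2)], and the mean value theorem collects it
    over a length of 1/2. *)
Lemma gateaux_lower_bound (R : realType) (U : normedModType R)
    (J : U -> R) (J' : U -> dual U) (W : set U) (c : R -> R) (u v : U) :
  gateaux_derivative J J' -> affine_set W ->
  (forall x, 0 <= x -> 0 <= c x) ->
  (forall x y, 0 <= x -> x <= y -> c x <= c y) ->
  (forall u v, W u -> W v -> c `|u - v| <= (J' u - J' v) (u - v)) ->
  W u -> W v ->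
  J u + J' u (v - u) + c (`|v - u| / 2) / 2 <= J v.
Proof.
move=> dJ affW c_ge0 c_mono J'_mono Wu Wv; set h := v - u.
pose g (t : R) : R^o := J (u + t *: h).
pose g' (t : R) : R := J' (u + t *: h) h.
have dg (t : R) : is_derive t 1 g (g' t) by exact: gateaux_derivative_line.
have cg a b : {within `[a, b], continuous (g : R -> R)}.
  apply: derivable_within_continuous => x _.
  by have [] := dg x.
have g'0 t : 0 < t -> c (t * `|h|) <= t * (g' t - g' 0).
  move=> t0; have := J'_mono _ _ (affW u v t Wu Wv) Wu; rewrite -/h.
  rewrite addrAC subrr add0r linearZ normrZ gtr0_norm// /g' scale0r addr0.
  exact.
have [x + gx] := @MVT_segment _ (g : R -> R) g' 0 2^-1 ltac:(lra)
  (fun x _ => dg x) (cg _ _).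
have [y + gy] := @MVT_segment _ (g : R -> R) g' 2^-1 1 ltac:(lra)
  (fun x _ => dg x) (cg _ _).
rewrite !in_itv/= => /andP[y2 y1] /andP[x0 _].
have g'x : g' 0 <= g' x.
  move: x0; rewrite le_eqVlt => /predU1P[<-//|x0].
  have := le_trans (c_ge0 _ (mulr_ge0 (ltW x0) (normr_ge0 h))) (g'0 x x0).
  by rewrite pmulr_rge0// subr_ge0.
have g'y : g' 0 + c (`|h| / 2) <= g' y.
  have y0 : 0 < y by lra.
  have ch : 0 <= c (`|h| / 2) by apply: c_ge0; exact: divr_ge0.
  rewrite -lerBrDl -(ler_pM2l y0) (le_trans _ (g'0 y y0))//.
  rewrite (@le_trans _ _ (c (`|h| / 2)))// ?ler_piMl//.
  apply: c_mono; first exact: divr_ge0.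
  by rewrite mulrC ler_wpM2r.
have g1 : g 1 = J v by rewrite /g scale1r /h addrC subrK.
have g0 : g 0 = J u by rewrite /g scale0r addr0.
have Eg0 : g' 0 = J' u h by rewrite /g' scale0r addr0.
move: gx gy g'x g'y; rewrite g1 g0 Eg0; lra.
Qed.


Section UniformlyMonotoneDerivative.
Context {R : realType} {U : normedModType R}.
Variables (J : U -> R) (J' : U -> dual U) (D : set U) (c : R -> R).
Hypothesis dJ : gateaux_derivative J J'.
Hypothesis D_affine : affine_set D.
Hypothesis c_ge0 : forall x, 0 <= x -> 0 <= c x.
Hypothesis c_mono : forall x y, 0 <= x -> x <= y -> c x <= c y.
Hypothesis J'_monotone :
  forall u v, D u -> D v -> c `|u - v| <= (J' u - J' v) (u - v).

(** Average the lower bounds at [u] and [v] based at their midpoint: the linear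
    terms cancel, and both distances are half of [|v - u|]. *)
Lemma monotone_derivative_midpoint u v : D u -> D v ->
  J (u + 2^-1 *: (v - u)) + c (`|v - u| / 2 / 2) / 2 <= (J u + J v) / 2.
Proof.
move=> Du Dv; set m := u + _.
have Dm : D m by exact: D_affine.
have um : u - m = - (2^-1 *: (v - u)) by rewrite /m opprD addNKr.
have vm : v - m = 2^-1 *: (v - u).
  rewrite /m opprD addrA -{1}(scale1r (v - u)) -scalerBl.
  by congr (_ *: _); lra.
have := gateaux_lower_bound _ _ _ _ _ _ _ _ dJ D_affine c_ge0 c_mono
  J'_monotone Dm Du.
have := gateaux_lower_bound _ _ _ _ _ _ _ _ dJ D_affine c_ge0 c_mono
  J'_monotone Dm Dv.
rewrite um vm linearN normrN normrZ gtr0_norm ?invr_gt0// [2^-1 * _]mulrC.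
lra.
Qed.

Lemma monotone_derivative_lsc u v : D u -> D v ->
  J u <= J v + dual_norm (J' u) * `|v - u|.
Proof.
move=> Du Dv.
have := gateaux_lower_bound _ _ _ _ _ _ _ _ dJ D_affine c_ge0 c_mono
  J'_monotone Du Dv.
have := c_ge0 _ (divr_ge0 (normr_ge0 (v - u)) (ltW (ltr0Sn R 1))).
have := dual_normP (J' u) (v - u); rewrite ler_norml => /andP[+ _].
lra.
Qed.

(** Growth bounds [J] below outside a ball, the supporting functional at [u]
    inside. *)
Lemma growing_bounded_below u : D u -> grows_at_infinity J D ->
  exists m : R, forall v, D v -> m <= J v.
Proof.
move=> Du /(_ (J u))[r Jr].
exists (J u - dual_norm (J' u) * (`|r| + `|u|)) => v Dv.
have [rv|vr] := leP r `|v|.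
  apply: le_trans (Jr v Dv rv).
  by rewrite gerBl mulr_ge0 ?dual_norm_ge0 ?addr_ge0.
rewrite lerBlDr (le_trans (monotone_derivative_lsc _ _ Du Dv))// lerD2l.
rewrite ler_wpM2l ?dual_norm_ge0// (le_trans (ler_normB _ _))// lerD2r.
by rewrite (le_trans (ltW vr))// ler_norm.
Qed.

End UniformlyMonotoneDerivative.

(** * Minimization of uniformly convex functionals *)

Section UniformlyConvexMinimization.
Context {R : realType} {U : completeNormedModType R}.
Variables (J : U -> R) (D : set U) (w : R -> R).
Hypothesis w_gt0 : forall e, 0 < e -> 0 < w e.
Hypothesis w_mono : forall x y, 0 <= x -> x <= y -> w x <= w y.
Hypothesis J_midpoint : forall u v, D u -> D v ->
  J (u + 2^-1 *: (v - u)) + w `|v - u| <= (J u + J v) / 2.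
Hypothesis J_lsc : forall u, D u ->
  exists C : R, forall v, D v -> J u <= J v + C * `|v - u|.

(** Each [J (u n) - e n] is a lower bound of [J] on [W n], so their supremum [L]
    is at most the infimum of [J] on the intersection of the [W n]; it is also
    the limit of [J (u n)]. *)
Lemma minimizing_sequence_cvg (W : nat -> set U) (e : nat -> R)
    (u : nat -> U) (v0 : U) :
  (forall n, closed (W n)) -> (forall n, affine_set (W n)) ->
  (forall n k, (n <= k)%N -> W k `<=` W n) -> W 0%N `<=` D ->
  (forall n, W n v0) -> e n @[n --> \oo] --> (0 : R) ->
  (forall n, W n (u n)) -> (forall n v, W n v -> J (u n) <= J v + e n) ->
  exists l : U, [/\ minimizer J (\bigcap_n W n) l,
    u n @[n --> \oo] --> l & J (u n) @[n --> \oo] --> J l].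
Proof.
move=> W_closed W_affine W_sub WD Wv0 e0 Wu u_min.
have DW n v : W n v -> D v by move=> Wv; apply: WD; exact: W_sub Wv.
pose A := range (fun n => J (u n) - e n); pose L := sup A.
have A0 : A !=set0 by exists (J (u 0%N) - e 0%N), 0%N.
have A_ub v : (forall n, W n v) -> ubound A (J v).
  by move=> Wv _ [n _ <-]; rewrite lerBlDr; exact: u_min.
have supA : has_sup A by split => //; exists (J v0); exact: A_ub.
have leL n : J (u n) <= L + e n.
  by rewrite -lerBlDr; apply: (ub_le_sup supA.2); exists n.
have tail d : 0 < d ->
    exists N, forall n, (N <= n)%N -> L - d < J (u n) /\ `|e n| < d.
  move=> d0; have [_ [N0 _ <-] N0L] := sup_adherent d0 supA.
  have /cvgr0Pnorm_lt/(_ d d0)[N1 _ N1e] := e0.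
  exists (maxn N0 N1) => n; rewrite geq_max => /andP[N0n N1n].
  split; last exact: N1e.
  rewrite (lt_le_trans N0L)// lerBlDr; apply: u_min.
  exact: W_sub N0n _ (Wu n).
(* If [`|u N - u k| >= d], the gain [w d] at the midpoint of [u N] and [u k]
   would push [J] there below its almost minimal value on [W N]. *)
have : cvg (u @ \oo).
  apply/cauchy_cvgP/cauchy_exP => d d0.
  have wd2 : 0 < w d / 2 by rewrite divr_gt0// w_gt0.
  have [N HN] := tail _ wd2.
  exists (u N); exists N => // k /= Nk; rewrite -ball_normE /= distrC ltNge.
  apply/negP => dk.
  have WNk : W N (u k) by exact: W_sub Nk _ (Wu k).
  have mid := J_midpoint _ _ (DW _ _ (Wu N)) (DW _ _ WNk).
  have minN := u_min N _ (W_affine N _ _ 2^-1 (Wu N) WNk).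
  have wk := w_mono _ _ (ltW d0) dk.
  have [LN] := HN N (leqnn N); rewrite ltr_norml => /andP[_ eN].
  have [_] := HN k Nk; rewrite ltr_norml => /andP[_ ek].
  have leLk := leL k.
  lra.
move=> /cvg_ex[l ul]; exists l.
have Wl n : W n l.
  apply: (closed_cvg (W n) (W_closed n) _ _ ul).
  by exists n => // k /= nk; exact: W_sub nk _ (Wu k).
have JuL : J (u n) @[n --> \oo] --> L.
  apply/cvgrPdist_lt => d d0; have [N HN] := tail d d0.
  exists N => // n /= /HN[Ln]; rewrite ltr_norml => /andP[_ en].
  by have leLn := leL n; rewrite ltr_distl; apply/andP; split; lra.
have JlL : J l <= L.
  have [C JlC] := J_lsc _ (DW _ _ (Wl 0%N)).
  have dist0 : J (u n) + C * `|u n - l| @[n --> \oo] --> L + C * 0.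
    apply: (cvgD JuL); apply: (cvgM (cvg_cst C)).
    rewrite -(@normr0 _ U) -(subrr l); apply: cvg_norm.
    by exact: (cvgB ul (cvg_cst l)).
  rewrite mulr0 addr0 in dist0.
  apply: (cvgr_to_ge dist0); apply: nearW => n.
  by apply: JlC; exact: DW (Wu n).
have LJ v : (forall n, W n v) -> L <= J v.
  by move=> Wv; apply: ge_sup => //; exact: A_ub.
split => //; last first.
  suff -> : J l = L by [].
  by apply/le_anti; rewrite JlL LJ.
split=> [n _ //|v Wv]; rewrite (le_trans JlL)// LJ// => n; exact: Wv.
Qed.

Lemma minimizer_exists (W : set U) (v0 : U) (m : R) :
  closed W -> affine_set W -> W `<=` D -> W v0 ->
  (forall v, W v -> m <= J v) -> exists u, minimizer J W u.
Proof.
move=> W_closed W_affine WD Wv0 mJ.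
have infJ : has_inf (J @` W).
  by split; [exists (J v0), v0|exists m => _ [v Wv <-]; exact: mJ].
have /choice[u u_min] : forall n : nat, exists u : U,
    W u /\ forall v, W v -> J u <= J v + harmonic n.
  move=> n.
  have [_ [v Wv <-] vlt] := inf_adherent (harmonic_gt0 n) infJ.
  exists v; split => // v' Wv'; rewrite (le_trans (ltW vlt))// lerD2r.
  by apply: (ge_inf infJ.2); exists v'.
have [l [lmin _ _]] := @minimizing_sequence_cvg (fun=> W) harmonic u v0
  (fun=> W_closed) (fun=> W_affine) (fun _ _ _ => @subset_refl _ W) WD
  (fun=> Wv0) cvg_harmonic (fun n => (u_min n).1) (fun n => (u_min n).2).
by exists l; move: lmin; rewrite bigcap_const//; exists 0%N.
Qed.

Lemma minimizer_unique (W : set U) (u v : U) : affine_set W -> W `<=` D ->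
  minimizer J W u -> minimizer J W v -> u = v.
Proof.
move=> W_affine WD [Wu u_min] [Wv v_min].
apply/eqP; rewrite eq_sym -subr_eq0 -normr_le0 leNgt; apply/negP => /w_gt0 w0.
have := J_midpoint _ _ (WD _ Wu) (WD _ Wv).
have := u_min _ (W_affine u v 2^-1 Wu Wv); have := v_min _ Wu.
lra.
Qed.

End UniformlyConvexMinimization.


(** * Approximate kernels *)

Section ApproximateKernels.
Context {R : realType} {U V : normedModType R}.
Variables (Gamma : {linear U -> V}) (psi : nat -> dual V).

Lemma approx_space_affine s : affine_set (approx_space Gamma psi s).
Proof.
move=> u v t Wu Wv j js.
rewrite addrC !linearP /= Wu// linearB linearB /= Wu// Wv//.
by rewrite subrr scaler0 addr0.
Qed.

Lemma approx_space_subset s t : (s <= t)%N ->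
  approx_space Gamma psi t `<=` approx_space Gamma psi s.
Proof. by move=> st u Wu j js; apply: Wu; exact: leq_trans st. Qed.

(** Every functional is a norm limit of combinations of the [psi j], all of
    which vanish at [Gamma u], so it vanishes there too. *)
Lemma kernel_space_bigcap s0 : complete_system psi ->
  kernel_space Gamma = \bigcap_s approx_space Gamma psi (s + s0).
Proof.
move=> psiC; apply/seteqP; split=> u.
  by move=> /= Gu0 s _ j _; rewrite Gu0 linear0.
move=> Wu; apply: dual_separates => phi.
have psi0 j : psi j (Gamma u) = 0.
  by apply: (Wu j.+1) => //=; rewrite addSn ltnS leq_addr.
apply/eqP; rewrite -normr_le0; apply/ler_addgt0Pl => e e0.
have d0 : 0 < e / (`|Gamma u| + 1).
  by rewrite divr_gt0// ltr_wpDl.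
have [n [a phi_psi]] := psiC phi _ d0.
set comb := \sum_(j < n) _ in phi_psi.
have combE : comb (Gamma u) = 0.
  have combS (s : seq 'I_n) :
      (\sum_(j <- s) a j *: psi j : dual V) (Gamma u) = 0.
    elim: s => [|j s IH]; first by rewrite big_nil.
    by rewrite big_cons -[LHS]/(a j *: psi j (Gamma u) + _) psi0 scaler0 add0r.
  exact: combS.
have : phi (Gamma u) = (phi - comb) (Gamma u).
  by rewrite -[RHS]/(phi (Gamma u) - comb (Gamma u)) combE subr0.
move=> ->; rewrite addr0 (le_trans (dual_normP _ _))//.
rewrite (@le_trans _ _ (e / (`|Gamma u| + 1) * (`|Gamma u| + 1)))//.
  apply: ler_pM => //; [exact: dual_norm_ge0|exact: ltW|by rewrite lerDl].
by rewrite divfK// gt_eqF// ltr_wpDl.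
Qed.

Lemma approx_space_closed s : bounded_near Gamma (nbhs (0 : U)) ->
  closed (approx_space Gamma psi s).
Proof.
move=> /linear_bounded_continuous Gc.
have -> : approx_space Gamma psi s =
    \bigcap_(j in [set j | (j < s)%N]) [set u | psi j (Gamma u) = 0].
  by apply/seteqP; split=> u Wu j js; exact: Wu.
apply: closed_bigI => j _.
have psic : continuous (psi j).
  by apply/linear_bounded_continuous; exact: (set_mem (dual_funP (psi j))).2.
apply: (@closed_comp _ _ (fun u => psi j (Gamma u)) [set x : R^o | x = 0]).
  by move=> u _; apply: continuous_comp; [exact: Gc|exact: psic].
exact: (@closed_eq R).
Qed.

End ApproximateKernels.

Theorem theorem2 (R : realType) (U V : completeNormedModType R)
    (U_reflexive : reflexive_space U)
    (J : U -> R) (J' : U -> dual U) (J'_derivative : gateaux_derivative J J')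
    (Gamma : {linear U -> V})
    (Gamma_bounded : bounded_near Gamma (nbhs (0 : U)))
    (psi : nat -> dual V) (psi_complete : complete_system psi)
    (s0 : nat)
    (J_grows : grows_at_infinity J (approx_space Gamma psi s0))
    (c : R -> R)
    (c_ge0 : forall x, 0 <= x -> 0 <= c x)
    (c_continuous : {within `[0, +oo[, continuous c})
    (c_increasing : {in `[0, +oo[ &, {homo c : x y / x < y}})
    (c0 : c 0 = 0)
    (J'_monotone : forall u v : U,
      approx_space Gamma psi s0 u -> approx_space Gamma psi s0 v ->
      c `|u - v| <= (J' u - J' v) (u - v)) :
  (exists ubar : U, minimizer J (kernel_space Gamma) ubar) /\
  (forall s : nat, (s0 <= s)%N ->
     exists u : U, minimizer J (approx_space Gamma psi s) u) /\
  (forall (ubar : U) (us : nat -> U),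
     minimizer J (kernel_space Gamma) ubar ->
     (forall s : nat, (s0 <= s)%N ->
        minimizer J (approx_space Gamma psi s) (us s)) ->
     us s @[s --> \oo] --> ubar /\ J (us s) @[s --> \oo] --> J ubar).

Proof.
pose W s := approx_space Gamma psi s.
have c_mono x y : 0 <= x -> x <= y -> c x <= c y.
  move=> x0; rewrite le_eqVlt => /predU1P[->//|xy].
  apply/ltW/c_increasing => //.
    by rewrite in_itv/= x0.
  by rewrite in_itv/= (le_trans x0)// ltW.
pose w r := c (r / 2 / 2) / 2.
have w_gt0 e : 0 < e -> 0 < w e.
  move=> e0; have e4 : 0 < e / 2 / 2 by rewrite !divr_gt0.
  rewrite divr_gt0// -c0; apply: c_increasing => //; rewrite in_itv/= ?lexx//.
  by rewrite ltW.
have w_mono x y : 0 <= x -> x <= y -> w x <= w y.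
  move=> x0 xy; rewrite ler_wpM2r// c_mono//; first by rewrite !divr_ge0.
  by rewrite !ler_wpM2r.
have W_affine s : affine_set (W s) by exact: approx_space_affine.
have W_closed s : closed (W s) by exact: approx_space_closed.
have W0 s : W s 0 by move=> j _; rewrite !linear0.
have mid : forall u v, W s0 u -> W s0 v ->
    J (u + 2^-1 *: (v - u)) + w `|v - u| <= (J u + J v) / 2.
  exact: monotone_derivative_midpoint.
have lsc u : W s0 u ->
    exists C : R, forall v, W s0 v -> J u <= J v + C * `|v - u|.
  move=> Wu; exists (dual_norm (J' u)) => v Wv.
  exact: (@monotone_derivative_lsc _ _ _ _ (W s0) c).
have [m mJ] := @growing_bounded_below _ _ _ _ _ _ J'_derivative (W_affine s0)
  c_ge0 c_mono J'_monotone 0 (W0 s0) J_grows.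
have kernelE := @kernel_space_bigcap _ _ _ Gamma psi s0 psi_complete.
have kernel_affine : affine_set (kernel_space Gamma).
  by rewrite kernelE => u v t Ku Kv s _; apply: W_affine; [exact: Ku|exact: Kv].
have kernelW : kernel_space Gamma `<=` W s0.
  by rewrite kernelE => u Ku; exact: (Ku 0%N).
have exists_min : forall (S : set U), closed S -> affine_set S ->
    S `<=` W s0 -> S 0 -> exists u, minimizer J S u.
  move=> S Sc Sa SW S0.
  apply: (minimizer_exists _ _ _ w_gt0 w_mono mid lsc S 0 m) => // v Sv.
  exact: mJ (SW _ Sv).
split.
  apply: exists_min => //; last by rewrite /kernel_space /= linear0.
  by rewrite kernelE; apply: closed_bigI => s _; exact: W_closed.
split=> [s s0s|ubar us ubar_min us_min].
  apply: (exists_min (W s)) => //.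
  exact: (approx_space_subset _ _ _ _ s0s).
have us_min0 n v : W (n + s0)%N v -> J (us (n + s0)%N) <= J v + 0.
  by rewrite addr0; exact: (us_min _ (leq_addl n s0)).2.
have [l [l_min usl Jl]] := @minimizing_sequence_cvg R U J (W s0) w w_gt0 w_mono
  mid lsc (fun n => W (n + s0)%N) (fun=> 0) (fun n => us (n + s0)%N) 0
  (fun n => W_closed _) (fun n => W_affine _)
  (fun n k nk => approx_space_subset _ _ _ _ (leq_add nk (leqnn s0)))
  (@subset_refl _ _) (fun n => W0 _) (@cvg_cst _ _ _ _ _)
  (fun n => (us_min _ (leq_addl n s0)).1)
  us_min0.
rewrite -kernelE in l_min.
have -> : ubar = l.
  exact: (minimizer_unique _ _ _ w_gt0 mid _ _ _ kernel_affine kernelW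
    ubar_min l_min).
by split; rewrite -(cvg_shiftn s0).
Qed.
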